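(* Let $(X,d,\mu)$ be a finite measure metric space with $X=\operatorname{supp}(\mu)$ whose measure satisfies the $n$-dimensional growth condition for some real $n>0$. Let $K(x,y)$ be a standard singular integral kernel with regularity exponent $\gamma$, $0<\gamma\leq 1$, which in addition satisfies: (i) there is a constant $C_3$ such that, for $\mu$-a.e. $x$, $\left|\int_{r_1<d(x,y)<r_2}K(x,y)\,d\mu(y)\right|\leq C_3$ for all $0<r_1<r_2<\infty$; (ii) $\lim_{\varepsilon\to 0}\int_{\varepsilon<d(x,y)<1}K(x,y)\,d\mu(y)$ exists for $\mu$-a.e. $x$. Let $0<\beta<\min(n,\gamma)$. Then for every $f\in Lip_\beta$ the principal value $$Kf(x)=\lim_{\varepsilon\to 0}\int_{\varepsilon<d(x,y)}K(x,y)f(y)\,d\mu(y)$$ is well defined for $\mu$-a.e. $x$, and the following two statements are equivalent: (a) $K1\in Lip_\beta$; (b) $K:Lip_\beta\to Lip_\beta$ is bounded.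
   Context: Setting: $(X,d)$ is a metric space and $\mu$ is a finite Borel measure on $X$ satisfying the $n$-dimensional growth condition: there are $n>0$ and a constant $A>0$ such that $\mu(B_r)\leq A r^n$ for all balls $B_r$ of radius $r$ and all $r>0$. The support of $\mu$ is assumed to be well defined, where $\operatorname{supp}(\mu)$ is the smallest closed set $F$ such that $\mu(E)=0$ for all Borel sets $E\subset F^c$; and it is assumed that $X=\operatorname{supp}(\mu)$. Lipschitz spaces: for $0<\beta\leq 1$, $\Lambda_\beta$ is the space of all bounded (complex-valued) functions $g$ on $X$ with $\sup_{x\neq y\in X}\frac{|g(x)-g(y)|}{d(x,y)^\beta}<\infty$. $Lip_\beta$ is the space of classes (modulo $\mu$-a.e. equality) of measurable functions $f$ for which there is $g\in\Lambda_\beta$ such that $f=g$ except on a set $E$ (depending on $f$) with $\mu(E)=0$. Its norm is $\|f\|_{Lip_\beta}=\|f\|_\infty+|f|_\beta$, where $\|f\|_\infty$ is the $L^\infty(\mu)$ norm and $$|f|_\beta=\sup_{x\neq y\in X}\frac{|g(x)-g(y)|}{d(x,y)^\beta}=\sup_{x\neq y\in X\setminus E}\frac{|f(x)-f(y)|}{d(x,y)^\beta}.$$ Singular integral kernels: let $\Omega=(X\times X)\setminus\Delta$, $\Delta=\{(x,y):x=y\}$. A function $K:\Omega\to\mathbb{C}$ is a standard singular integral kernel (with regularity exponent $\gamma$) if there are constants $C_1,C_2$ and a number $\gamma$, $0<\gamma\leq 1$, such that $$|K(x,y)|\leq\frac{C_1}{d(x,y)^n},$$ $$|K(x_1,y)-K(x_2,y)|\leq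 C_2\frac{d(x_1,x_2)^\gamma}{d(x_1,y)^{n+\gamma}}\quad\text{whenever } 2d(x_1,x_2)\leq d(x_1,y).$$ Here $1$ denotes the constant function equal to $1$ on $X$. *)

(* Defs.v *)
From HB Require Import structures.
From mathcomp Require Import all_boot all_order all_algebra.
From mathcomp Require Import all_classical all_reals all_analysis.
From mathcomp Require Import complex.

Set Implicit Arguments.
Unset Strict Implicit.
Unset Printing Implicit Defensive.

Import Order.TTheory GRing.Theory Num.Theory.
Import numFieldNormedType.Exports.
Import ComplexField.Normc.

Local Open Scope classical_set_scope.
Local Open Scope ring_scope.
Local Open Scope complex_scope.

HB.mixin Record isBorel (d : measure_display) (K : numDomainType) X
    & Metric K X & Measurable d X := {
  measurable_borelE : (@measurable d X) = <<s (@open X) >> ;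
}.

(* Metric spaces equipped with their Borel sigma-algebra; as for every
   [measurableType], the carrier is inhabited. *)
#[short(type="borelMetricType")]
HB.structure Definition BorelMetric (d : measure_display) (K : numDomainType) :=
  { X of Metric K X & Measurable d X & isBorel d K X }.

Section ComplexFunctions.
Context {R : realType} {d : measure_display} {X : measurableType d}.

(* Complex measurability and integration, componentwise: the library only
   integrates (extended-)real-valued functions. *)
Definition cmeasurable_fun (D : set X) (f : X -> R[i]) : Prop :=
  measurable_fun D (fun x => complex.Re (f x)) /\
  measurable_fun D (fun x => complex.Im (f x)).

Definition cintegral (mu : {measure set X -> \bar R}) (D : set X)
    (f : X -> R[i]) : R[i] :=
  (\int[mu]_(x in D) complex.Re (f x)) +i* (\int[mu]_(x in D) complex.Im (f x)).

End ComplexFunctions.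

Section SingularIntegrals.
Context {R : realType} {d : measure_display} {X : borelMetricType d R}.
Implicit Types (mu : {finite_measure set X -> \bar R}) (n beta gamma : R).
Implicit Types (K : X -> X -> R[i]) (f g h : X -> R[i]).

Definition growth_condition mu n : Prop :=
  exists2 A : R, 0 < A &
    forall (x : X) (r : R), 0 < r -> (mu (ball x r) <= (A * r `^ n)%:E)%E.

Definition closed_conull mu (F : set X) : Prop :=
  closed F /\ forall E : set X, measurable E -> E `<=` ~` F -> mu E = 0%E.

Definition is_support mu (F : set X) : Prop :=
  closed_conull mu F /\ forall F' : set X, closed_conull mu F' -> F `<=` F'.

(* The supremum is over the empty set (value -oo) when X is a singleton; a
   measure with support X that satisfies the growth condition rules this out,
   since it has no atom. *)
Definition lip_seminorm beta g : \bar R :=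
  ereal_sup [set (normc (g p.1 - g p.2) / mdist p.1 p.2 `^ beta)%:E
            | p in [set p : X * X | p.1 != p.2]].

Definition Lambda beta : set (X -> R[i]) :=
  [set g | (exists M : R, forall x, normc (g x) <= M) /\
           (lip_seminorm beta g < +oo)%E].

(* Elements of the space Lip_beta of classes are handled through their
   (measurable) representatives. *)
Definition Lip mu beta : set (X -> R[i]) :=
  [set f | cmeasurable_fun setT f /\
           exists2 g, Lambda beta g & f = g %[ae mu]].

(* The function g of Lambda_beta equal to f almost everywhere; it is unique
   when X is the support of mu, because such functions are continuous. *)
Definition lip_rep mu beta f : X -> R[i] :=
  xget (cst 0) [set g | Lambda beta g /\ f = g %[ae mu]].

Definition Lip_norm mu beta f : \bar R :=
  (Lnorm mu +oo (fun x => (normc (f x))%:E) +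
   lip_seminorm beta (lip_rep mu beta f))%E.

(* A function on (X * X) minus the diagonal is a total function whose values on
   the diagonal are never used. *)
Definition standard_kernel n gamma K : Prop :=
  (exists C1 : R, forall x y : X, x != y ->
     normc (K x y) <= C1 / mdist x y `^ n) /\
  (exists C2 : R, forall x1 x2 y : X, x1 != y ->
     2 * mdist x1 x2 <= mdist x1 y ->
     normc (K x1 y - K x2 y) <=
       C2 * (mdist x1 x2 `^ gamma / mdist x1 y `^ (n + gamma))).

Definition bounded_annular_integrals mu K : Prop :=
  exists C3 : R, {ae mu, forall x, forall r1 r2 : R, 0 < r1 -> r1 < r2 ->
    normc (cintegral mu [set y : X | r1 < mdist x y < r2] (K x)) <= C3}.

(* R[i]^o is R[i] with the topology of its norm. *)
Definition convergent_local_integrals mu K : Prop :=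
  {ae mu, forall x,
    cvg ((cintegral mu [set y : X | e < mdist x y < 1] (K x) : R[i]^o)
           @[e --> (0 : R)^'+])}.

Definition truncated mu K f (x : X) (e : R) : R[i]^o :=
  cintegral mu [set y : X | e < mdist x y] (fun y => K x y * f y).

(* The operator K; meaningful at the points x where the limit exists. *)
Definition pv mu K f (x : X) : R[i] :=
  lim (truncated mu K f x e @[e --> (0 : R)^'+]).

(* The class of an almost everywhere defined function belongs to Lip_beta. *)
Definition in_Lip mu beta f : Prop :=
  exists2 h, Lip mu beta h & f = h %[ae mu].

Definition Lip_bounded mu beta (T : (X -> R[i]) -> (X -> R[i])) : Prop :=
  exists C : R, forall f, Lip mu beta f ->
    exists h, [/\ Lip mu beta h, T f = h %[ae mu] &
                  (Lip_norm mu beta h <= C%:E * Lip_norm mu beta f)%E].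

End SingularIntegrals.

(* Main.v *)
Require Import Defs.
From HB Require Import structures.
From mathcomp Require Import all_boot all_order all_algebra.
From mathcomp Require Import all_classical all_reals all_analysis.
From mathcomp Require Import measurable_realfun ess_sup_inf complex ring lra.

Set Implicit Arguments.
Unset Strict Implicit.
Unset Printing Implicit Defensive.

Import Order.TTheory GRing.Theory Num.Theory.
Import numFieldNormedType.Exports.

Local Open Scope classical_set_scope.
Local Open Scope ring_scope.

Import ComplexField.Normc.

(** The kernel is too singular to be integrated against f directly, so the value
    of f at the center is subtracted: if g in Lambda_beta represents f, then
    [Kf = reg_op g + g * K1] almost everywhere, where
    [reg_op g x = int_(y != x) K(x,y) (g(y) - g(x)) dmu(y)].
    The integrand of [reg_op g x] is O(d(x,y)^(beta-n)), which the growth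
    condition makes integrable near x, so [reg_op g x] is an absolutely
    convergent integral at every x ([diff_kernel_all]).  The truncations of Kf
    differ from [reg_op g x] plus g(x) times those of K1 by O(e^beta)
    ([truncated_error]), hence they converge wherever those of K1 do, that is,
    almost everywhere by (ii) ([truncated_cvg]).

    The heart of the proof is that [reg_op] maps beta-Hoelder functions to
    beta-Hoelder functions with control of the constants ([reg_op_holder]).  For
    r = d(x,z), the parts of both integrals over d(x,y) <= 2r are O(r^beta) by
    size alone ([diff_kernel_near]).  Over d(x,y) > 2r the difference of the
    integrands is
    [(K(x,y) - K(z,y)) (g(y) - g(z)) + K(x,y) (g(z) - g(x))]:
    the regularity of K and beta < gamma make the first term contribute
    O(r^beta) ([kernel_difference_far]), and in the second term g(z) - g(x) is
    constant in y, so the bound (i) on the annular integrals of K applies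
    ([away_kernel_le]).  As (i) holds only for almost every x, this first gives
    the estimate when x is good ([reg_op_holder_good]); good points are dense
    because mu has full support, and the general case follows by passing through
    a good point.

    Therefore Kf is in Lip_beta, with the right norm, as soon as g * K1 is, and
    Lip_beta is stable under products ([holderM_add]): (a) implies (b).
    Conversely the constant function 1 is in Lip_beta. *)

(** * Complex modulus and complex integrals *)

Section ComplexNumbers.
Context {R : rcfType}.
Implicit Types z w : R[i].

Lemma normc_ge0 z : 0 <= normc z.
Proof. by case: z => a b; exact: sqrtr_ge0. Qed.

Lemma le_normcB z w : normc (z - w) <= normc z + normc w.
Proof. by rewrite -(normcN w); exact: le_normcD. Qed.

Lemma Re_le_normc z : `|complex.Re z| <= normc z.
Proof. by case: z => a b /=; rewrite -sqrtr_sqr ler_wsqrtr// lerDl sqr_ge0. Qed.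

Lemma Im_le_normc z : `|complex.Im z| <= normc z.
Proof. by case: z => a b /=; rewrite -sqrtr_sqr ler_wsqrtr// lerDr sqr_ge0. Qed.

Lemma normc_le_ReIm z : normc z <= `|complex.Re z| + `|complex.Im z|.
Proof.
case: z => a b /=; rewrite -[leRHS]ger0_norm ?addr_ge0// -[leRHS]sqrtr_sqr.
rewrite ler_wsqrtr// sqrrD !real_normK ?num_real//.
by rewrite lerD2r lerDl mulrn_wge0// mulr_ge0.
Qed.

End ComplexNumbers.

Section ComplexIntegral.
Context {R : realType} {d : measure_display} {X : measurableType d}.
Variable mu : {measure set X -> \bar R}.
Implicit Types (D : set X) (f g : X -> R[i]).

Definition cintegrable D f : Prop :=
  mu.-integrable D (fun x => (complex.Re (f x))%:E) /\
  mu.-integrable D (fun x => (complex.Im (f x))%:E).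

Lemma cmeasurable_funS D E f : measurable D -> E `<=` D ->
  cmeasurable_fun D f -> cmeasurable_fun E f.
Proof. by move=> mD ED [mr mi]; split; exact: measurable_funS mD ED _. Qed.

Lemma cmeasurable_cst D (c : R[i]) : cmeasurable_fun D (fun=> c).
Proof. by split; exact: measurable_cst. Qed.

Lemma cmeasurableD D f g : cmeasurable_fun D f -> cmeasurable_fun D g ->
  cmeasurable_fun D (fun x => f x + g x).
Proof.
move=> [fr fi] [gr gi]; split.
- apply: (eq_measurable_fun (fun x => complex.Re (f x) + complex.Re (g x))).
    by move=> x _; case: (f x) (g x) => ? ? [].
  exact: measurable_funD.
- apply: (eq_measurable_fun (fun x => complex.Im (f x) + complex.Im (g x))).
    by move=> x _; case: (f x) (g x) => ? ? [].
  exact: measurable_funD.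
Qed.

Lemma cmeasurableM D f g : cmeasurable_fun D f -> cmeasurable_fun D g ->
  cmeasurable_fun D (fun x => f x * g x).
Proof.
move=> [fr fi] [gr gi]; split.
- apply: (eq_measurable_fun (fun x => complex.Re (f x) * complex.Re (g x) -
    complex.Im (f x) * complex.Im (g x))).
    by move=> x _; case: (f x) (g x) => ? ? [].
  by apply: measurable_funB; exact: measurable_funM.
- apply: (eq_measurable_fun (fun x => complex.Re (f x) * complex.Im (g x) +
    complex.Im (f x) * complex.Re (g x))).
    by move=> x _; case: (f x) (g x) => ? ? [].
  by apply: measurable_funD; exact: measurable_funM.
Qed.

Lemma cmeasurableB D f g : cmeasurable_fun D f -> cmeasurable_fun D g ->
  cmeasurable_fun D (fun x => f x - g x).
Proof.
move=> mf mg; have := cmeasurableD mf (cmeasurableM (cmeasurable_cst D (-1)) mg).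
by congr cmeasurable_fun; apply/funext => x; rewrite mulN1r.
Qed.

Lemma cintegrableS D E f : measurable D -> measurable E -> E `<=` D ->
  cintegrable D f -> cintegrable E f.
Proof. by move=> mD mE ED [fr fi]; split; exact: integrableS mD mE ED _. Qed.

Lemma eq_cintegral D f g : (forall x, D x -> f x = g x) ->
  cintegral mu D f = cintegral mu D g.
Proof.
move=> fg; rewrite /cintegral; congr (_ +i* _)%C;
  by apply: eq_Rintegral => x /set_mem Dx; rewrite fg.
Qed.

Lemma cintegralD D f g : measurable D -> cintegrable D f -> cintegrable D g ->
  cintegral mu D (fun x => f x + g x) = cintegral mu D f + cintegral mu D g.
Proof.
move=> mD [fr fi] [gr gi]; rewrite /cintegral.
have -> : (fun x => complex.Re (f x + g x)) =
          (fun x => complex.Re (f x) + complex.Re (g x)).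
  by apply/funext => x; case: (f x) (g x) => ? ? [].
have -> : (fun x => complex.Im (f x + g x)) =
          (fun x => complex.Im (f x) + complex.Im (g x)).
  by apply/funext => x; case: (f x) (g x) => ? ? [].
by rewrite !RintegralD.
Qed.

Lemma cintegralZl D (c : R[i]) f : measurable D -> cintegrable D f ->
  cintegral mu D (fun x => c * f x) = c * cintegral mu D f.
Proof.
move=> mD [fr fi]; rewrite /cintegral; case: c => a b.
have -> : (fun x => complex.Re ((a +i* b)%C * f x)) =
          (fun x => a * complex.Re (f x) - b * complex.Im (f x)).
  by apply/funext => x; case: (f x).
have -> : (fun x => complex.Im ((a +i* b)%C * f x)) =
          (fun x => a * complex.Im (f x) + b * complex.Re (f x)).
  by apply/funext => x; case: (f x).
have iZ (k : R) (h : X -> R) : mu.-integrable D (EFin \o h) ->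
    mu.-integrable D (EFin \o (fun x => k * h x)).
  by move=> ih; exact: (integrableZl mD k ih).
rewrite RintegralB ?iZ// RintegralD ?iZ//.
by rewrite !RintegralZl.
Qed.

Lemma cintegrableZl D (c : R[i]) f : measurable D -> cintegrable D f ->
  cintegrable D (fun x => c * f x).
Proof.
move=> mD [fr fi]; case: c => a b; split.
- have := integrableB mD (integrableZl mD a fr) (integrableZl mD b fi).
  by congr (_.-integrable _ _); apply/funext => x /=; case: (f x).
- have := integrableD mD (integrableZl mD a fi) (integrableZl mD b fr).
  by congr (_.-integrable _ _); apply/funext => x /=; case: (f x).
Qed.

Lemma cintegrableN D f : cintegrable D f -> cintegrable D (fun x => - f x).
Proof.
move=> [fr fi]; split.
- have := integrableN fr; congr (_.-integrable _ _).
  by apply/funext => x /=; case: (f x).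
- have := integrableN fi; congr (_.-integrable _ _).
  by apply/funext => x /=; case: (f x).
Qed.

Lemma cintegralB D f g : measurable D -> cintegrable D f -> cintegrable D g ->
  cintegral mu D (fun x => f x - g x) = cintegral mu D f - cintegral mu D g.
Proof.
move=> mD fi gi; rewrite cintegralD//; last exact: cintegrableN.
have := cintegralZl (-1) mD gi; rewrite mulN1r => <-.
by congr (_ + _); apply: eq_cintegral => x _; rewrite mulN1r.
Qed.

Lemma cintegral_setU D E f : measurable D -> measurable E ->
  [disjoint D & E] -> cintegrable (D `|` E) f ->
  cintegral mu (D `|` E) f = cintegral mu D f + cintegral mu E f.
Proof.
by move=> mD mE DE [fr fi]; rewrite /cintegral !Rintegral_setU.
Qed.

Lemma ae_eq_cintegral D f g : measurable D ->
  cmeasurable_fun D f -> cmeasurable_fun D g ->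
  {ae mu, forall x, D x -> f x = g x} -> cintegral mu D f = cintegral mu D g.
Proof.
move=> mD [fr fi] [gr gi] fg; rewrite /cintegral /Rintegral.
congr (fine _ +i* fine _)%C; apply: ae_eq_integral => //;
  [exact/measurable_EFinP|exact/measurable_EFinP| |
   exact/measurable_EFinP|exact/measurable_EFinP|];
  by apply: filterS fg => x + Dx => ->.
Qed.

(** The real and imaginary parts are estimated separately, hence the
    factor 2. *)
Lemma cintegral_le D f (w : X -> R) (M : R) : measurable D ->
  cmeasurable_fun D f -> measurable_fun D w ->
  (forall x, D x -> normc (f x) <= w x) ->
  (\int[mu]_(x in D) (w x)%:E <= M%:E)%E ->
  cintegrable D f /\ normc (cintegral mu D f) <= 2 * M.
Proof.
move=> mD [fr fi] mw fw wM.
have w0 x : D x -> 0 <= w x by move=> /fw; apply: le_trans; exact: normc_ge0.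
have part (h : X -> R) : measurable_fun D h ->
    (forall x, D x -> `|h x| <= w x) ->
    mu.-integrable D (fun x => (h x)%:E) /\ `|\int[mu]_(x in D) h x| <= M.
  move=> mh hw.
  have le : (\int[mu]_(x in D) `|(h x)%:E| <= M%:E)%E.
    apply: le_trans wM; apply: ge0_le_integral => //.
    - by do 2 apply: measurableT_comp => //.
    - exact/measurable_EFinP.
  have ih : mu.-integrable D (fun x => (h x)%:E).
    apply/integrableP; split; first exact/measurable_EFinP.
    exact: le_lt_trans le (ltry _).
  split => //; rewrite -lee_fin EFin_normr_Rintegral//; apply: le_trans le.
  by apply: le_abse_integral => //; exact/measurable_EFinP.
have [ir rM] := part _ fr (fun x Dx => le_trans (Re_le_normc _) (fw x Dx)).
have [ii iM] := part _ fi (fun x Dx => le_trans (Im_le_normc _) (fw x Dx)).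
split => //; apply: le_trans (normc_le_ReIm _) _.
by rewrite mulr_natl mulr2n lerD.
Qed.

End ComplexIntegral.

(** * Real powers and limits *)

Section PowerFunctions.
Context {R : realType}.
Implicit Types a b c s t : R.

Lemma powR_le a b s : 0 <= s -> 0 <= a -> a <= b -> a `^ s <= b `^ s.
Proof.
by move=> s0 a0 ab; rewrite ge0_ler_powR// nnegrE// (le_trans a0).
Qed.

Lemma powR_small s e : 0 < s -> 0 < e ->
  exists2 del, 0 < del & forall t, 0 <= t -> t <= del -> t `^ s <= e.
Proof.
move=> s0 e0; exists (e `^ s^-1); first exact: powR_gt0.
move=> t t0 te; have := powR_le (ltW s0) t0 te.
by rewrite -powRrM mulVf ?gt_eqF// powRr1// ltW.
Qed.

(** The form in which a limit is taken along points of a dense set: the error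
    M * t ^ s is that of a Hoelder continuous function at distance t. *)
Lemma le_small_powR s M a c : 0 < s -> 0 <= M ->
  (forall del, 0 < del -> exists t, [/\ 0 <= t, t < del & c <= a + M * t `^ s]) ->
  c <= a.
Proof.
move=> s0 M0 H; apply/ler_addgt0Pr => e e0.
have [|del del0 Hdel] := @powR_small s (e / (M + 1)) s0.
  by rewrite divr_gt0// ltr_wpDl.
have [t [t0 td]] := H _ del0; move=> /le_trans; apply; rewrite lerD2l.
have M1 : 0 < M + 1 by rewrite ltr_wpDl.
apply: (@le_trans _ _ (M * (e / (M + 1)))).
  by rewrite ler_wpM2l// Hdel// ltW.
by rewrite mulrCA ler_piMr ?(ltW e0)// ler_pdivrMr// mul1r lerDl.
Qed.

End PowerFunctions.

Lemma powR_decr {R : realType} (a b s : R) : s <= 0 -> 0 < a -> a <= b ->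
  b `^ s <= a `^ s.
Proof.
move=> s0 a0 ab; have b0 := lt_le_trans a0 ab.
rewrite -(opprK s) !(powRN _ (- s)) lef_pV2 ?posrE ?powR_gt0//.
by apply: powR_le => //; [rewrite oppr_ge0|exact: ltW].
Qed.

Lemma powR2_lt1 {R : realType} (s : R) : s < 0 -> 2 `^ s < 1 :> R.
Proof.
move=> s0; rewrite -(opprK s) powRN invf_lt1 ?powR_gt0//.
have := @gt0_ltr_powR _ (- s); rewrite oppr_gt0 => /(_ s0 1 2).
by rewrite powR1; apply; rewrite ?nnegrE ?ltr1n.
Qed.

(** Convergence in [R[i]^o] is tested against radii in R[i], which are positive
    only when they are real. *)
Lemma cvg_complex0 {R : realType} (s c : R) (h : R -> R[i]^o) : 0 < s -> 0 <= c ->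
  (forall e, 0 < e -> normc (h e) <= c * e `^ s) ->
  h e @[e --> (0 : R)^'+] --> (0 : R[i]^o).
Proof.
move=> s0 c0 hc; apply/cvgr0Pnorm_lt => -[a b] /=.
rewrite ltcE/= => /andP[/eqP -> a0].
have c1 : 0 < c + 1 by rewrite ltr_wpDl.
have [|del del0 H] := @powR_small _ s (a / (c + 1)) s0; first exact: divr_gt0.
near=> e; have e0 : 0 < e by near: e; exact: nbhs_right_gt.
have ed : e <= del by near: e; exact: nbhs_right_le.
have -> : `|h e| = (normc (h e))%:C%C by rewrite normc_def; case: (h e).
rewrite ltcE/= eqxx/=; apply: le_lt_trans (hc e e0) _.
apply: (@le_lt_trans _ _ (c * (a / (c + 1)))).
  by rewrite ler_wpM2l// H// ltW.
by rewrite mulrCA gtr_pMr// ltr_pdivrMr// mul1r ltrDl.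
Unshelve. all: by end_near. Qed.

(** * Measurability in Borel metric spaces *)

Section BorelMetric.
Context {R : realType} {d : measure_display} {X : borelMetricType d R}.

Lemma open_measurable_set (A : set X) : open A -> measurable A.
Proof. by move=> oA; rewrite measurable_borelE; exact: sub_sigma_algebra. Qed.

Lemma continuous_measurable (f : X -> R) :
  (forall x e, 0 < e -> exists2 del, 0 < del &
     forall y, mdist x y < del -> `|f x - f y| < e) ->
  measurable_fun setT f.
Proof.
move=> cf; apply: (measurability _ (RGenOInfty.measurableE R)) => //.
move=> /= _ [_ [a ->] <-]; rewrite preimage_itvoy setTI.
apply: open_measurable_set; rewrite openE => x /= fxa.
have [del del0 H] := cf x (f x - a) ltac:(by rewrite subr_gt0).
apply/nbhs_ballP; exists del => //= y; rewrite ballEmdist/= => /H.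
by rewrite ltr_norml => /andP[_]; rewrite ltrD2l ltrN2.
Qed.

Lemma measurable_mdist (x : X) : measurable_fun setT (mdist x).
Proof.
apply: continuous_measurable => y e e0; exists e => // z yz.
rewrite ltr_norml; apply/andP; split.
  rewrite ltrBrDr addrC ltrBlDr; apply: le_lt_trans (metric_triangle x y z) _.
  by rewrite ltrD2l.
rewrite ltrBlDr addrC; apply: le_lt_trans (metric_triangle x z y) _.
by rewrite ltrD2l metric_sym.
Qed.

Lemma measurable_mdist_gt (x : X) r : measurable [set y | r < mdist x y].
Proof.
have := measurable_mdist x measurableT (measurable_itv `]r, +oo[).
by rewrite setTI preimage_itvoy.
Qed.

Lemma measurable_mdist_lt (x : X) r : measurable [set y | mdist x y < r].
Proof.
have := measurable_mdist x measurableT (measurable_itv `]-oo, r[).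
by rewrite setTI preimage_itvNyo.
Qed.

Lemma measurable_mdist_le (x : X) r : measurable [set y | mdist x y <= r].
Proof.
have := measurable_mdist x measurableT (measurable_itv `]-oo, r]).
by rewrite setTI preimage_itvNyc.
Qed.

Lemma measurable_mdist_powR (x : X) s :
  measurable_fun setT (fun y => mdist x y `^ s).
Proof. exact: measurableT_comp (measurable_powR s) (measurable_mdist x). Qed.

End BorelMetric.

(** * Measures of full support *)

Section FullSupport.
Context {R : realType} {d : measure_display} {X : borelMetricType d R}.
Variable mu : {finite_measure set X -> \bar R}.
Hypothesis hsupp : is_support mu [set: X].

(** A ball on which P nowhere holds would be an open null set, and its complement
    a closed conull set smaller than the support. *)
Lemma ae_dense (P : X -> Prop) (x : X) (del : R) : {ae mu, forall y, P y} ->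
  0 < del -> exists2 y, mdist x y < del & P y.
Proof.
move=> [N [mN N0 PN]] del0; apply: contrapT => noP.
have ballN : ball x del `<=` N.
  move=> y; rewrite ballEmdist/= => xy; apply: PN => Py.
  by apply: noP; exists y.
have [_ /(_ (~` (ball x del)°))] := hsupp; apply.
- split; first by apply: open_closedC; exact: open_interior.
  move=> E mE; rewrite setCK => Eb; apply/eqP; rewrite -measure_le0 -N0.
  apply: le_measure; rewrite ?inE//.
  exact: subset_trans Eb (subset_trans (@interior_subset _ _) ballN).
- exact: I.
- exact: nbhsx_ballx.
Qed.

Lemma mu_setT_gt0 : (0 < mu [set: X])%E.
Proof.
rewrite lt0e measure_ge0 andbT; apply/eqP => mu0.
have [] := @ae_dense (fun=> False) point 1 _ ltr01 => //.
by exists setT; split => //.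
Qed.

(** The growth condition excludes atoms, so a single point cannot carry the
    mass.  This keeps the supremum defining [lip_seminorm] from being -oo. *)
Lemma exists_distinct n : 0 < n -> growth_condition mu n ->
  exists x y : X, x != y.
Proof.
move=> n0 [A A0 hA]; apply: contrapT => one.
have allE (x y : X) : x = y.
  by apply: contrapT => /eqP xy; apply: one; exists x, y.
have fin : mu [set: X] \is a fin_num by exact: fin_num_measure.
have := mu_setT_gt0; rewrite -(fineK fin) lte_fin ltNge => /negP; apply.
apply: (@le_small_powR _ n A) => // [|del del0]; first exact: ltW.
exists (del / 2); split.
- by rewrite divr_ge0// ltW.
- by rewrite gtr_pMr// invf_lt1// ltr1n.
rewrite add0r -lee_fin (fineK fin).
apply: le_trans (hA point (del / 2) _); last by rewrite divr_gt0.
rewrite (_ : ball _ _ = setT)//; apply/seteqP; split => // y _.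
by rewrite (allE y point); apply: ballxx; rewrite divr_gt0.
Qed.

End FullSupport.

(** * Lipschitz spaces and their representatives *)

Section LipschitzSpaces.
Context {R : realType} {d : measure_display} {X : borelMetricType d R}.
Variable mu : {finite_measure set X -> \bar R}.
Variable beta : R.
Hypothesis beta0 : 0 < beta.
Implicit Types (f g h : X -> R[i]) (M : R).

(** Includes the diagonal, where the right-hand side vanishes as beta is
    positive: it is equivalent to an upper bound on [lip_seminorm]. *)
Definition holder M g : Prop :=
  forall x y, normc (g x - g y) <= M * mdist x y `^ beta.

Lemma holder_lip_seminorm M g : holder M g -> (lip_seminorm beta g <= M%:E)%E.
Proof.
move=> gM; apply: ge_ereal_sup => _ [[x y]/= xy <-].
by rewrite lee_fin ler_pdivrMr ?powR_gt0 ?mdist_gt0.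
Qed.

Lemma lip_seminorm_holder M g : (lip_seminorm beta g <= M%:E)%E -> holder M g.
Proof.
move=> gM x y; have [->|xy] := eqVneq x y.
  by rewrite subrr normc0 mdistxx powR0 ?mulr0// gt_eqF.
rewrite -ler_pdivrMr ?powR_gt0 ?mdist_gt0// -lee_fin.
by apply: le_trans gM; apply: ereal_sup_ubound; exists (x, y).
Qed.

Lemma holder_cmeasurable M g : 0 <= M -> holder M g -> cmeasurable_fun setT g.
Proof.
move=> M0 gM.
have main (h : X -> R) : (forall x y, `|h x - h y| <= normc (g x - g y)) ->
    measurable_fun setT h.
  move=> hg; apply: continuous_measurable => x e e0.
  have M1 : 0 < M + 1 by rewrite ltr_wpDl.
  have [|del del0 H] := @powR_small _ beta (e / (M + 1)) beta0.
    by rewrite divr_gt0.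
  exists del => // y xy; apply: le_lt_trans (hg _ _) _.
  apply: le_lt_trans (gM _ _) _.
  apply: (@le_lt_trans _ _ (M * (e / (M + 1)))).
    by rewrite ler_wpM2l// H ?mdist_ge0// ltW.
  by rewrite mulrCA gtr_pMr// ltr_pdivrMr// mul1r ltrDl.
split; apply: main => x y.
- by apply: le_trans (Re_le_normc _); case: (g x) (g y) => ? ? [].
- by apply: le_trans (Im_le_normc _); case: (g x) (g y) => ? ? [].
Qed.

Hypothesis hsupp : is_support mu [set: X].

(** Both functions are continuous, and they agree on a dense set.  Hence
    [lip_rep] returns the function itself on elements of Lambda_beta. *)
Lemma Lambda_ae_eq g h : Lambda beta g -> Lambda beta h -> g = h %[ae mu] ->
  g = h.
Proof.
have LH (k : X -> R[i]) : Lambda beta k -> exists2 M, 0 <= M & holder M k.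
  move=> [_]; case E : (lip_seminorm beta k) => [r| |]// _.
    exists (Num.max r 0); first by rewrite le_max lexx orbT.
    by apply: lip_seminorm_holder; rewrite E lee_fin le_max lexx.
  by exists 0 => //; apply: lip_seminorm_holder; rewrite E leNye.
move=> /LH[Mg Mg0 gM] /LH[Mh Mh0 hM] gh; apply/funext => x.
apply/eqP; rewrite -subr_eq0; apply/eqP/eq0_normc/eqP.
rewrite eq_le normc_ge0 andbT.
apply: (@le_small_powR _ beta (Mg + Mh)) => //; first exact: addr_ge0.
move=> del del0; have [y xy /(_ I) gy] := ae_dense hsupp x gh del0.
exists (mdist x y); split => //; first exact: mdist_ge0.
rewrite add0r mulrDl (_ : g x - h x = (g x - g y) - (h x - h y)).
  by apply: le_trans (le_normcB _ _) _; rewrite lerD.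
by rewrite gy opprB addrA subrK.
Qed.

Lemma holder_Lambda M0 M1 g : (forall x, normc (g x) <= M0) -> holder M1 g ->
  Lambda beta g.
Proof.
move=> g0 g1; split; first by exists M0.
exact: le_lt_trans (holder_lip_seminorm g1) (ltry _).
Qed.

Lemma holder_Lip M0 M1 h : 0 <= M0 -> 0 <= M1 ->
  (forall x, normc (h x) <= M0) -> holder M1 h ->
  Lip mu beta h /\ (Lip_norm mu beta h <= (M0 + M1)%:E)%E.
Proof.
move=> M00 M10 h0 h1; have Lh := holder_Lambda h0 h1.
have Lip_h : Lip mu beta h.
  split; first exact: holder_cmeasurable h1.
  by exists h => //; exact: ae_eq_refl.
have repE : lip_rep mu beta h = h.
  have [L hr] : Lambda beta (lip_rep mu beta h) /\ h = lip_rep mu beta h %[ae mu].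
    apply: (@xgetPex _ (cst 0) [set g | Lambda beta g /\ h = g %[ae mu]]).
    by exists h; split => //; exact: ae_eq_refl.
  by apply/esym; exact: Lambda_ae_eq.
split => //; rewrite /Lip_norm repE EFinD leeD ?holder_lip_seminorm//.
rewrite unlock (mu_setT_gt0 hsupp); apply/ess_supP; apply: nearW => x /=.
by rewrite lee_fin ger0_norm ?normc_ge0.
Qed.

(** An essential bound holds on a dense set, hence everywhere by continuity of
    the representative. *)
Lemma le_Lnorm_holder f g M1 M x : 0 <= M1 -> holder M1 g -> f = g %[ae mu] ->
  (Lnorm mu +oo (fun x => (normc (f x))%:E) <= M%:E)%E ->
  normc (g x) <= M.
Proof.
move=> M10 g1 fg; rewrite unlock (mu_setT_gt0 hsupp) => /ess_supP fM.
apply: (@le_small_powR _ beta M1) => // del del0.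
have [|y xy [/(_ I) fgy fyM]] := @ae_dense _ _ _ _ hsupp
  (fun y => ([set: X] y -> f y = g y) /\ normc (f y) <= M) x del _ del0.
  apply: filterS2 fg fM => y fgy /=; rewrite lee_fin ger0_norm ?normc_ge0//.
exists (mdist x y); split => //; first exact: mdist_ge0.
rewrite -[g x](subrK (g y)) addrC; apply: le_trans (le_normcD _ _) _.
by rewrite lerD// -fgy.
Qed.

(** Trades the extended-real norm of a class for two real bounds on its
    continuous representative whose sum is exactly the norm. *)
Lemma Lip_rep_bounds n f : 0 < n -> growth_condition mu n -> Lip mu beta f ->
  exists g M0 M1, [/\ f = g %[ae mu], 0 <= M0 /\ 0 <= M1,
    forall x, normc (g x) <= M0, holder M1 g &
    Lip_norm mu beta f = (M0 + M1)%:E].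
Proof.
move=> n0 hgr [mf [g0 Lg0 fg0]].
have [Lg fg] : Lambda beta (lip_rep mu beta f) /\ f = lip_rep mu beta f %[ae mu].
  apply: (@xgetPex _ (cst 0) [set g | Lambda beta g /\ f = g %[ae mu]]).
  by exists g0.
have [x [y xy]] := exists_distinct hsupp n0 hgr.
set g := lip_rep mu beta f in Lg fg *.
have s0 : (0 <= lip_seminorm beta g)%E.
  apply: (@le_trans _ _ (normc (g x - g y) / mdist x y `^ beta)%:E).
    by rewrite lee_fin divr_ge0 ?normc_ge0 ?powR_ge0.
  by apply: ereal_sup_ubound; exists (x, y).
have [[C gC] soo] := Lg.
have sfin : lip_seminorm beta g \is a fin_num by rewrite ge0_fin_numE.
have N0 : (0 <= Lnorm mu +oo (fun x => (normc (f x))%:E))%E by exact: Lnorm_ge0.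
have Nfin : Lnorm mu +oo (fun x => (normc (f x))%:E) \is a fin_num.
  rewrite ge0_fin_numE//; apply: (@le_lt_trans _ _ C%:E); last exact: ltry.
  rewrite unlock (mu_setT_gt0 hsupp); apply/ess_supP.
  apply: filterS fg => z /(_ I) fgz /=.
  by rewrite lee_fin ger0_norm ?normc_ge0// fgz.
have g1 : holder (fine (lip_seminorm beta g)) g.
  by apply: lip_seminorm_holder; rewrite fineK.
exists g, (fine (Lnorm mu +oo (fun x => (normc (f x))%:E))), (fine (lip_seminorm beta g)).
split => //.
- by rewrite !fine_ge0.
- move=> z; apply: (le_Lnorm_holder z _ g1 fg); first by rewrite fine_ge0.
  by rewrite fineK.
- by rewrite EFinD !fineK.
Qed.

End LipschitzSpaces.

(** The shape of Kf, with f, g, h standing for the regularized operator, the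
    representative of the function, and that of K1. *)
Lemma holderM_add {R : realType} {d : measure_display} {X : borelMetricType d R}
    (beta : R) (f g h : X -> R[i]) (M M0 M1 N0 N1 : R) :
  holder beta M f -> holder beta M1 g -> holder beta N1 h ->
  (forall x, normc (g x) <= M0) -> (forall x, normc (h x) <= N0) ->
  holder beta (M + (M0 * N1 + M1 * N0)) (fun x => f x + g x * h x).
Proof.
move=> fM gM hM g0 h0 x y.
rewrite (_ : _ - _ = (f x - f y) + (g x * (h x - h y) + (g x - g y) * h y));
  last by ring.
rewrite [leRHS](_ : _ = M * mdist x y `^ beta +
  (M0 * (N1 * mdist x y `^ beta) + M1 * mdist x y `^ beta * N0)); last by ring.
apply: le_trans (le_normcD _ _) _; apply: lerD => //.
apply: le_trans (le_normcD _ _) _; rewrite !normcM; apply: lerD;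
  by apply: ler_pM; rewrite ?normc_ge0.
Qed.

(** * Integrals of powers of the distance *)

Section GrowthIntegrals.
Context {R : realType} {d : measure_display} {X : borelMetricType d R}.
Variable mu : {finite_measure set X -> \bar R}.
Variables (n : R).
Hypothesis n0 : 0 < n.

(** Cover D by the annuli with radii between rho q^k and 2 rho q^k.  On the k-th
    annulus the integrand is at most (rho q^k)^(s-n), and the growth condition
    bounds the mass by A (2 rho q^k)^n, so the contributions are dominated by the
    geometric series of ratio q^s.  Taking q < 1 with s > 0, or q > 1 with s < 0,
    yields the estimate near a point and the one far from it. *)
Lemma geometric_annuli_integral (A : R) (x : X) (s q rho : R) (D : set X) :
  0 <= A -> (forall r, 0 < r -> (mu (ball x r) <= (A * r `^ n)%:E)%E) ->
  s <= n -> 0 < q -> q `^ s < 1 -> 0 < rho -> measurable D ->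
  (forall y, D y -> exists k, rho * q ^+ k <= mdist x y < 2 * (rho * q ^+ k)) ->
  (\int[mu]_(y in D) (mdist x y `^ (s - n))%:E <=
     (A * 2 `^ n / (1 - q `^ s) * rho `^ s)%:E)%E.
Proof.
move=> A0 hA sn q0 qs1 rho0 mD cover.
pose rad k := rho * q ^+ k.
have rad0 k : 0 < rad k by rewrite mulr_gt0// exprn_gt0.
pose B k := [set y | mdist x y < 2 * rad k].
have mB k : measurable (B k) by exact: measurable_mdist_lt.
pose F k (y : X) : \bar R := ((rad k `^ (s - n))%:E * (\1_(B k) y)%:E)%E.
have F0 k y : (0 <= F k y)%E by rewrite mule_ge0 ?lee_fin ?powR_ge0.
have mF k : measurable_fun D (F k).
  apply: emeasurable_funM => //; apply/measurable_EFinP.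
  exact: measurable_funTS.
apply: (@le_trans _ _ (\int[mu]_(y in D) \sum_(k <oo) F k y)%E).
  apply: ge0_le_integral => //.
  - by move=> y _; rewrite lee_fin powR_ge0.
  - apply/measurable_EFinP; apply: measurable_funTS.
    exact: measurable_mdist_powR.
  - by apply: ge0_emeasurable_sum => *; [exact: F0|exact: mF].
  move=> y Dy; have [k /andP[kl ku]] := cover _ Dy.
  apply: le_trans (nneseries_lim_ge k.+1 _); last by move=> *; exact: F0.
  rewrite big_nat_recr//=; apply: (@le_trans _ _ (F k y)); last first.
    by rewrite leeDr// sume_ge0.
  rewrite /F indicE mem_set// mule1 lee_fin powR_decr//.
  by rewrite subr_le0.
rewrite integral_nneseries//.
have term k : (\int[mu]_(y in D) F k y <=
    (geometric (A * 2 `^ n * rho `^ s) (q `^ s) k)%:E)%E.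
  rewrite ge0_integralZl//; first last.
  - by rewrite lee_fin powR_ge0.
  - by apply/measurable_EFinP; exact: measurable_funTS.
  rewrite integral_indic//; apply: (@le_trans _ _ ((rad k `^ (s - n))%:E * mu (B k))%E).
    rewrite lee_wpmul2l ?lee_fin ?powR_ge0// le_measure ?inE//.
    exact: measurableI.
  have -> : B k = ball x (2 * rad k) by rewrite ballEmdist.
  have := hA (2 * rad k) ltac:(by rewrite mulr_gt0).
  move=> /(lee_wpmul2l (x := (rad k `^ (s - n))%:E)).
  rewrite lee_fin powR_ge0 => /(_ isT) /le_trans; apply.
  rewrite -EFinM lee_fin /geometric/= powRB; last by rewrite (gt_eqF (rad0 k)) implybT.
  rewrite powRM ?(ltW (rad0 _))//.
  have -> : rad k `^ s = rho `^ s * (q `^ s) ^+ k.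
    rewrite /rad powRM ?(ltW rho0) ?exprn_ge0 ?(ltW q0)//; congr (_ * _).
    by rewrite -powR_mulrn ?(ltW q0)// powRAC powR_mulrn ?powR_ge0.
  have rn0 : rad k `^ n != 0 by rewrite gt_eqF// powR_gt0.
  by rewrite le_eqVlt; apply/orP; left; apply/eqP; field.
apply: lime_le.
  by apply: is_cvg_nneseries => k _ _; exact: integral_ge0.
apply: nearW => m; apply: (@le_trans _ _
    (\sum_(0 <= k < m) (geometric (A * 2 `^ n * rho `^ s) (q `^ s) k)%:E)%E).
  by apply: lee_sum => k _; exact: term.
rewrite sumEFin lee_fin.
have := @geometric_le_lim _ m (A * 2 `^ n * rho `^ s) (q `^ s).
rewrite ger0_norm ?powR_ge0// => /(_ _ _ qs1) H.
apply: le_trans (H _ _) _; rewrite ?powR_gt0//.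
  by rewrite !mulr_ge0 ?powR_ge0.
by rewrite mulrAC.
Qed.

Lemma exists_exp2_gt (t : R) : exists k : nat, t < 2 ^+ k.
Proof.
exists (Num.truncn t).+1; apply: lt_le_trans (truncnS_gt t) _.
by rewrite -natrX ler_nat ltnW// ltn_expl.
Qed.

Hypothesis hgr : growth_condition mu n.

Lemma near_integral s : 0 < s -> s <= n -> exists2 C, 0 <= C &
  forall x r, 0 < r ->
    (\int[mu]_(y in [set y | (0 < mdist x y < r)%R]) (mdist x y `^ (s - n))%:E
       <= (C * r `^ s)%:E)%E.
Proof.
move=> s0 sn; have [A /ltW A0 hA] := hgr.
have q1 : 2^-1 `^ s < 1 :> R.
  by rewrite -powR_inv1// -powRrM mulN1r powR2_lt1// oppr_lt0.
exists (A * 2 `^ n / (1 - 2^-1 `^ s)).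
  by rewrite !mulr_ge0 ?powR_ge0// invr_ge0 subr_ge0 ltW.
move=> x r r0; apply: (@le_trans _ _ (A * 2 `^ n / (1 - 2^-1 `^ s) * (r / 2) `^ s)%:E).
  apply: geometric_annuli_integral => //.
  - exact: hA.
  - exact: divr_gt0.
  - rewrite (_ : [set _ | _] = [set y | 0 < mdist x y] `&` [set y | mdist x y < r]).
      by apply: measurableI; [exact: measurable_mdist_gt|exact: measurable_mdist_lt].
    by apply/seteqP; split => y /= => [/andP[]//|[-> ->]].
  move=> y /= /andP[y0 yr].
  (* The annulus containing y is given by the first k for which its inner radius
     is at most d(x,y). *)
  pose P k := r / 2 * 2^-1 ^+ k <= mdist x y.
  have exP : exists k, P k.
    have [k hk] := exists_exp2_gt (r / 2 / mdist x y); exists k.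
    rewrite /P exprVn ler_pdivrMr ?exprn_gt0// ltW//.
    by move: hk; rewrite ltr_pdivrMr// [_ ^+ _ * _]mulrC.
  case: (ex_minnP exP) => k Pk mink; exists k; apply/andP; split => //.
  case: k Pk mink => [|k] Pk mink.
    by rewrite expr0 mulr1 mulrC divfK// gt_eqF.
  have : ~~ P k by apply/negP => /mink; rewrite ltnn.
  rewrite /P -ltNge => /lt_le_trans; apply.
  by rewrite exprS mulrCA (mulrA 2) divff// mul1r.
rewrite lee_fin ler_wpM2l//.
  by rewrite !mulr_ge0 ?powR_ge0// invr_ge0 subr_ge0 ltW.
by rewrite powR_le ?ltW// ?divr_gt0// gtr_pMr// invf_lt1// ltr1n.
Qed.

Lemma far_integral s : s < 0 -> exists2 C, 0 <= C &
  forall x r, 0 < r ->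
    (\int[mu]_(y in [set y | (r < mdist x y)%R]) (mdist x y `^ (s - n))%:E
       <= (C * r `^ s)%:E)%E.
Proof.
move=> s0; have [A /ltW A0 hA] := hgr.
have q1 : 2 `^ s < 1 :> R by exact: powR2_lt1.
exists (A * 2 `^ n / (1 - 2 `^ s)).
  by rewrite !mulr_ge0 ?powR_ge0// invr_ge0 subr_ge0 ltW.
move=> x r r0; apply: geometric_annuli_integral => //.
- exact: hA.
- by rewrite ltW// (lt_trans s0).
- exact: measurable_mdist_gt.
move=> y /= ry.
pose P k := mdist x y < 2 * (r * 2 ^+ k).
have exP : exists k, P k.
  have [k hk] := exists_exp2_gt (mdist x y / r); exists k.
  rewrite ltr_pdivrMr// mulrC in hk; apply: lt_le_trans hk _.
  by rewrite ler_peMl ?ler1n// mulr_ge0 ?exprn_ge0// ltW.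
case: (ex_minnP exP) => k Pk mink; exists k; apply/andP; split => //.
case: k Pk mink => [|k] Pk mink; first by rewrite expr0 mulr1 ltW.
have : ~~ P k by apply/negP => /mink; rewrite ltnn.
by rewrite /P -leNgt; apply: le_trans; rewrite exprS mulrCA.
Qed.

End GrowthIntegrals.

(** * The regularized singular integral *)

Section Kernel.
Context {R : realType} {d : measure_display} {X : borelMetricType d R}.
Variable mu : {finite_measure set X -> \bar R}.
Variables (n gamma beta : R) (K : X -> X -> R[i]) (C1 C2 : R).
Hypothesis n0 : 0 < n.
Hypothesis hgr : growth_condition mu n.
Hypothesis hKmeas : forall x : X, cmeasurable_fun [set y | y != x] (K x).
Hypotheses (C10 : 0 <= C1) (C20 : 0 <= C2).
Hypothesis hK1 : forall x y : X, x != y -> normc (K x y) <= C1 / mdist x y `^ n.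
Hypothesis hK2 : forall x1 x2 y : X, x1 != y ->
  2 * mdist x1 x2 <= mdist x1 y ->
  normc (K x1 y - K x2 y) <=
    C2 * (mdist x1 x2 `^ gamma / mdist x1 y `^ (n + gamma)).
Hypotheses (beta0 : 0 < beta) (beta_n : beta < n) (beta_gamma : beta < gamma).
Implicit Types (g : X -> R[i]) (x y z : X) (r : R) (D : set X).

Let m := fine (mu [set: X]).
Let m0 : 0 <= m. Proof. exact: fine_ge0. Qed.

Definition away x r : set X := [set y | r < mdist x y].

Let mA x r : measurable (away x r). Proof. exact: measurable_mdist_gt. Qed.

Lemma away_subset x r : 0 <= r -> away x r `<=` away x 0.
Proof. by move=> r0 y; exact: le_lt_trans. Qed.

Lemma integral_le_mass D (w : X -> R) c : measurable D -> measurable_fun D w ->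
  0 <= c -> (forall y, D y -> 0 <= w y <= c) ->
  (\int[mu]_(y in D) (w y)%:E <= (c * m)%:E)%E.
Proof.
move=> mD mw c0 wc.
apply: (@le_trans _ _ (\int[mu]_(y in D) (cst c%:E) y)%E).
  apply: ge0_le_integral => //.
  - by move=> y /wc/andP[]; rewrite lee_fin.
  - exact/measurable_EFinP.
  - by move=> y /wc/andP[]; rewrite lee_fin.
rewrite integral_cst// EFinM fineK ?fin_num_measure//.
by rewrite lee_wpmul2l ?lee_fin// le_measure ?inE.
Qed.

Lemma cintegral_le_mass D (f : X -> R[i]) c : measurable D ->
  cmeasurable_fun D f -> 0 <= c -> (forall y, D y -> normc (f y) <= c) ->
  cintegrable mu D f /\ normc (cintegral mu D f) <= 2 * (c * m).
Proof.
move=> mD mf c0 fc; apply: (@cintegral_le _ _ _ mu D f (cst c)) => //.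
by apply: integral_le_mass => // y _; rewrite c0 /=.
Qed.

Lemma kernel_measurable x D : measurable D -> D `<=` away x 0 ->
  cmeasurable_fun D (K x).
Proof.
move=> mD DA; apply: cmeasurable_funS (hKmeas x).
- rewrite (_ : [set _ | _] = away x 0)//; apply/seteqP; split => y /=.
    by rewrite /away/= mdist_gt0 eq_sym.
  by rewrite /away/= mdist_gt0 eq_sym.
- by move=> y /DA; rewrite /away/= mdist_gt0 eq_sym.
Qed.

Lemma kernel_integrable x r D : 0 < r -> measurable D ->
  (forall y, D y -> r <= mdist x y) ->
  cintegrable mu D (K x) /\
  normc (cintegral mu D (K x)) <= 2 * (C1 / r `^ n * m).
Proof.
move=> r0 mD Dr; apply: cintegral_le_mass => //.
- by apply: kernel_measurable => // y /Dr; exact: lt_le_trans.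
- by rewrite divr_ge0 ?powR_ge0.
move=> y /Dr ry; apply: le_trans (hK1 _) _.
  by rewrite -mdist_gt0 (lt_le_trans r0).
rewrite ler_wpM2l// lef_pV2 ?posrE ?powR_gt0 ?(lt_le_trans r0)//.
by apply: powR_le => //; exact: ltW.
Qed.

Lemma away_split x r r' : r < r' ->
  away x r = [set y | r < mdist x y < r'] `|` [set y | r' <= mdist x y].
Proof.
move=> rr'; apply/seteqP; split => y; rewrite /away/=.
  by move=> ->; have [?|?] := leP r' (mdist x y); [right|left].
by case=> [/andP[]//|]; exact: lt_le_trans.
Qed.

Lemma measurable_annulus x r r' : measurable [set y | r < mdist x y < r'].
Proof.
rewrite (_ : [set _ | _] = away x r `&` [set y | mdist x y < r']).
  by apply: measurableI => //; exact: measurable_mdist_lt.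
by apply/seteqP; split => y /= => [/andP[]//|[-> ->]].
Qed.

Lemma measurable_mdist_ge x r : measurable [set y | r <= mdist x y].
Proof.
rewrite (_ : [set _ | _] = ~` [set y | mdist x y < r]).
  by apply: measurableC; exact: measurable_mdist_lt.
by apply/seteqP; split => y /=; rewrite leNgt => /negP.
Qed.

Lemma away_kernel_split x r r' : 0 < r -> r < r' ->
  cintegral mu (away x r) (K x) =
  cintegral mu [set y | r < mdist x y < r'] (K x) +
  cintegral mu [set y | r' <= mdist x y] (K x).
Proof.
move=> r0 rr'; rewrite (away_split _ rr') cintegral_setU//.
- exact: measurable_annulus.
- exact: measurable_mdist_ge.
- apply/disj_setPS => y [/= /andP[_ yr] ry].
  by move: (lt_le_trans yr ry); rewrite ltxx.
- rewrite -(away_split _ rr').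
  by have [] := @kernel_integrable x r (away x r) r0 (mA _ _) (fun y => @ltW _ _ _ _).
Qed.

(** The annulus up to r + 1 is controlled by the cancellation hypothesis; beyond
    radius r + 1 >= 1 the kernel is bounded by C1 and the measure is finite. *)
Lemma away_kernel_le x r C3 : 0 < r ->
  (forall r1 r2 : R, 0 < r1 -> r1 < r2 ->
    normc (cintegral mu [set y : X | r1 < mdist x y < r2] (K x)) <= C3) ->
  normc (cintegral mu (away x r) (K x)) <= C3 + 2 * (C1 * m).
Proof.
move=> r0 hC3; have rr : r < r + 1 by rewrite ltrDl.
rewrite (away_kernel_split x r0 rr); apply: le_trans (le_normcD _ _) _.
apply: lerD; first exact: hC3.
have [|_] := @kernel_integrable x 1 _ ltr01 (measurable_mdist_ge x (r + 1)).
  by move=> y /=; apply: le_trans; rewrite lerDr ltW.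
by rewrite powR1 divr1.
Qed.

Definition diff_kernel g x y : R[i] := K x y * (g y - g x).

(** The principal value of K against g, corrected by g(x) K1(x); unlike the
    principal value it is an absolutely convergent integral. *)
Definition reg_op g x : R[i] := cintegral mu (away x 0) (diff_kernel g x).

Lemma diff_kernel_measurable g x D : measurable D -> D `<=` away x 0 ->
  cmeasurable_fun setT g -> cmeasurable_fun D (diff_kernel g x).
Proof.
move=> mD DA mg; apply: cmeasurableM; first exact: kernel_measurable.
apply: cmeasurableB; last exact: cmeasurable_cst.
exact: cmeasurable_funS mg.
Qed.

Lemma diff_kernel_le g M1 x y : 0 <= M1 -> holder beta M1 g -> 0 < mdist x y ->
  normc (diff_kernel g x y) <= C1 * M1 * mdist x y `^ (beta - n).
Proof.
move=> M10 gM xy; rewrite /diff_kernel normcM.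
rewrite powRB; last by rewrite (gt_eqF xy) implybT.
rewrite (_ : C1 * M1 * _ = (C1 / mdist x y `^ n) * (M1 * mdist x y `^ beta)).
  rewrite ler_pM ?normc_ge0 ?hK1 -?mdist_gt0//.
  by rewrite metric_sym; exact: gM.
by ring.
Qed.

Lemma integralZl_le D s (c B : R) x : measurable D -> 0 <= c ->
  (\int[mu]_(y in D) (mdist x y `^ s)%:E <= B%:E)%E ->
  (\int[mu]_(y in D) (c * mdist x y `^ s)%:E <= (c * B)%:E)%E.
Proof.
move=> mD c0 IB; under eq_integral do rewrite EFinM.
rewrite ge0_integralZl//.
- by rewrite EFinM lee_wpmul2l.
- by apply/measurable_EFinP; apply: measurable_funTS; exact: measurable_mdist_powR.
- by move=> y _; rewrite lee_fin powR_ge0.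
Qed.

Let mw D c x s : measurable_fun D (fun y => c * mdist x y `^ s).
Proof.
apply: measurable_funM => //.
by apply: measurable_funTS; exact: measurable_mdist_powR.
Qed.

(** By size alone: the integrand is O(d(x,y)^(beta-n)), and the integral of this
    power over the points within r of x is O(r^beta). *)
Lemma diff_kernel_near : exists2 C, 0 <= C &
  forall g M1 x r D, 0 <= M1 -> holder beta M1 g -> 0 < r ->
    measurable D -> D `<=` [set y | 0 < mdist x y < r] ->
    normc (cintegral mu D (diff_kernel g x)) <= C * M1 * r `^ beta.
Proof.
have [C C0 HC] := near_integral hgr beta0 (ltW beta_n).
exists (2 * C1 * C); first by rewrite !mulr_ge0.
move=> g M1 x r D M10 gM r0 mD Dr.
have D0 : D `<=` away x 0 by move=> y /Dr /= /andP[].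
have [||||_] := @cintegral_le _ _ _ mu D (diff_kernel g x)
  (fun y => C1 * M1 * mdist x y `^ (beta - n)) (C1 * M1 * (C * r `^ beta)) mD.
- by apply: diff_kernel_measurable => //; exact: holder_cmeasurable gM.
- by [].
- by move=> y /D0; exact: diff_kernel_le.
- apply: integralZl_le => //; first exact: mulr_ge0.
  apply: le_trans (HC x r r0); apply: ge0_subset_integral => //.
  + exact: measurable_annulus.
  + by apply/measurable_EFinP; apply: measurable_funTS; exact: measurable_mdist_powR.
  + by move=> y _; rewrite lee_fin powR_ge0.
by move=> /le_trans; apply; rewrite le_eqVlt; apply/orP; left; apply/eqP; ring.
Qed.

Lemma diff_kernel_all : exists2 C, 0 <= C &
  forall g M1 x, 0 <= M1 -> holder beta M1 g ->
    cintegrable mu (away x 0) (diff_kernel g x) /\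
    normc (reg_op g x) <= C * M1.
Proof.
have [C C0 HC] := near_integral hgr beta0 (ltW beta_n).
exists (2 * C1 * (C + m)); first by rewrite !mulr_ge0// addr_ge0.
move=> g M1 x M10 gM.
have [||||ig le] := @cintegral_le _ _ _ mu (away x 0) (diff_kernel g x)
  (fun y => C1 * M1 * mdist x y `^ (beta - n)) (C1 * M1 * (C + m)) (mA _ _).
- by apply: diff_kernel_measurable => //; exact: holder_cmeasurable gM.
- by [].
- by move=> y; exact: diff_kernel_le.
- apply: integralZl_le => //; first exact: mulr_ge0.
  rewrite (away_split x ltr01) ge0_integral_setU//; first last.
  + apply/disj_setPS => y [/= /andP[_ yr] ry].
    by move: (lt_le_trans yr ry); rewrite ltxx.
  + by move=> y _; rewrite lee_fin powR_ge0.
  + by apply/measurable_EFinP; apply: measurable_funTS; exact: measurable_mdist_powR.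
  + exact: measurable_mdist_ge.
  + exact: measurable_annulus.
  rewrite EFinD leeD//.
    by have := HC x 1 ltr01; rewrite powR1 mulr1.
  rewrite -[m]mul1r; apply: integral_le_mass => //.
  + exact: measurable_mdist_ge.
  + by apply: measurable_funTS; exact: measurable_mdist_powR.
  + move=> y /= ry; rewrite powR_ge0/=.
    have bn : beta - n <= 0 by rewrite subr_le0 ltW.
    by have := powR_decr bn ltr01 ry; rewrite powR1.
split => //; apply: le_trans le _.
by rewrite le_eqVlt; apply/orP; left; apply/eqP; ring.
Qed.

Lemma reg_op_split g M1 x D E : 0 <= M1 -> holder beta M1 g ->
  measurable D -> measurable E -> [disjoint D & E] -> away x 0 = D `|` E ->
  reg_op g x =
    cintegral mu D (diff_kernel g x) + cintegral mu E (diff_kernel g x).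
Proof.
move=> M10 gM mD mE DE ADE; have [C _ /(_ g M1 x M10 gM)[ig _]] := diff_kernel_all.
by rewrite /reg_op ADE cintegral_setU// -ADE.
Qed.

(** On d(x,y) > 2 d(x,z) the regularity of K applies and d(y,z) <= 2 d(x,y), so
    with r = d(x,z) the integrand is O(r^gamma d(x,y)^(beta-gamma-n)).  Its
    integral converges at infinity because beta < gamma, and is
    O(r^gamma r^(beta-gamma)). *)
Lemma kernel_difference_far : exists2 C, 0 <= C &
  forall g M1 x z, 0 <= M1 -> holder beta M1 g -> x != z ->
    cintegrable mu (away x (2 * mdist x z))
      (fun y => (K x y - K z y) * (g y - g z)) /\
    normc (cintegral mu (away x (2 * mdist x z))
      (fun y => (K x y - K z y) * (g y - g z))) <= C * M1 * mdist x z `^ beta.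
Proof.
have s0 : beta - gamma < 0 by rewrite subr_lt0.
have [C C0 HC] := far_integral n0 hgr s0.
exists (2 * C2 * 2 `^ beta * C); first by rewrite !mulr_ge0 ?powR_ge0.
move=> g M1 x z M10 gM xz; set r := mdist x z; set W := away x (2 * r).
have r0 : 0 < r by rewrite mdist_gt0.
have W0 : W `<=` away x 0 by apply: away_subset; rewrite mulr_ge0// ltW.
have Wz y : W y -> mdist x y / 2 < mdist z y.
  rewrite /W /away /= => ry.
  have := metric_triangle x z y; rewrite -/r; lra.
have Wz0 : W `<=` away z 0.
  move=> y Wy; apply: le_lt_trans (Wz y Wy); rewrite divr_ge0//.
  exact: mdist_ge0.
pose c := C2 * M1 * 2 `^ beta * r `^ gamma.
have c0 : 0 <= c by rewrite !mulr_ge0 ?powR_ge0.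
have [||||ig le] := @cintegral_le _ _ _ mu W
  (fun y => (K x y - K z y) * (g y - g z))
  (fun y => c * mdist x y `^ (beta - gamma - n))
  (c * (C * (2 * r) `^ (beta - gamma))) (mA _ _).
- have mg := holder_cmeasurable beta0 M10 gM.
  apply: cmeasurableM; apply: cmeasurableB.
  + exact: kernel_measurable (mA _ _) W0.
  + exact: kernel_measurable (mA _ _) Wz0.
  + exact: cmeasurable_funS mg.
  + exact: cmeasurable_cst.
- by [].
- move=> y Wy; have xy0 : 0 < mdist x y by exact: W0.
  have Wy' : 2 * r < mdist x y by [].
  rewrite normcM (_ : c * _ = (C2 * (r `^ gamma / mdist x y `^ (n + gamma))) *
    (M1 * (2 * mdist x y) `^ beta)).
    apply: ler_pM; rewrite ?normc_ge0//.
      by apply: hK2; [rewrite -mdist_gt0|exact: ltW].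
    apply: le_trans (gM _ _) _; rewrite ler_wpM2l//; apply: powR_le => //.
    - exact: ltW.
    - exact: mdist_ge0.
    have := metric_triangle y x z; rewrite (metric_sym y x) -/r; lra.
  rewrite /c powRM// ?(ltW xy0)//.
  rewrite (_ : beta - gamma - n = beta - (n + gamma)); last by ring.
  rewrite powRB; last by rewrite (gt_eqF xy0) implybT.
  by ring.
- by apply: integralZl_le; [exact: mA|by []|apply: HC; rewrite mulr_gt0].
split => //; apply: le_trans le _.
apply: (@le_trans _ _ (2 * (c * (C * r `^ (beta - gamma))))).
  do 3 (rewrite ler_wpM2l//); apply: powR_decr; rewrite ?(ltW s0)//; lra.
rewrite powRB; last by rewrite (gt_eqF r0) implybT.
rewrite le_eqVlt; apply/orP; left; apply/eqP; rewrite /c.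
have : r `^ gamma != 0 by rewrite gt_eqF// powR_gt0.
by move=> rg0; field.
Qed.

(** The cancellation bound is used at x only, so z may be any point; this
    asymmetry is what allows the extension to all pairs of points. *)
Lemma reg_op_holder_good C3 : 0 <= C3 -> exists2 C, 0 <= C &
  forall g M1 x z, 0 <= M1 -> holder beta M1 g ->
    (forall r1 r2 : R, 0 < r1 -> r1 < r2 ->
      normc (cintegral mu [set y : X | r1 < mdist x y < r2] (K x)) <= C3) ->
    normc (reg_op g x - reg_op g z) <= C * M1 * mdist x z `^ beta.
Proof.
move=> C30.
have [Cn Cn0 HCn] := diff_kernel_near.
have [Cf Cf0 HCf] := kernel_difference_far.
have [Ca Ca0 HCa] := diff_kernel_all.
exists (Cn * 4 `^ beta + Cn * 4 `^ beta + (Cf + (C3 + 2 * (C1 * m)))).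
  by rewrite !addr_ge0// ?mulr_ge0 ?powR_ge0.
move=> g M1 x z M10 gM good.
have [->|xz] := eqVneq x z.
  by rewrite subrr normc0 !mulr_ge0 ?powR_ge0// !addr_ge0// ?mulr_ge0 ?powR_ge0.
set r := mdist x z; have r0 : 0 < r by rewrite mdist_gt0.
have r20 : 0 < 2 * r by rewrite mulr_gt0.
set W := away x (2 * r); set B := [set y | mdist x y <= 2 * r].
have mB : measurable B by exact: measurable_mdist_le.
have W0 : W `<=` away x 0 by apply: away_subset; rewrite ltW.
have Wz0 : W `<=` away z 0.
  move=> y; rewrite /W /away /= => ry.
  have := metric_triangle x z y; rewrite -/r; lra.
have splitE u : W `<=` away u 0 -> away u 0 = (away u 0 `&` B) `|` W.
  move=> Wu; apply/seteqP; split => y /=.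
    by move=> uy; have [?|?] := leP (mdist x y) (2 * r); [left|right].
  by case=> [[]//|/Wu].
have disjE u : [disjoint (away u 0 `&` B) & W].
  apply/disj_setPS => y [[_ /= yr] ry].
  by move: (le_lt_trans yr ry); rewrite ltxx.
have mN u : measurable (away u 0 `&` B) by exact: measurableI.
have Nx : normc (cintegral mu (away x 0 `&` B) (diff_kernel g x)) <=
    Cn * M1 * (4 * r) `^ beta.
  apply: HCn => //; first by rewrite mulr_gt0.
  by move=> y [/= xy yr]; rewrite xy/=; apply: le_lt_trans yr _; lra.
(* The points within 2r of x are within 3r of z. *)
have Nz : normc (cintegral mu (away z 0 `&` B) (diff_kernel g z)) <=
    Cn * M1 * (4 * r) `^ beta.
  apply: HCn => //; first by rewrite mulr_gt0.
  move=> y [/= zy yr]; rewrite zy/=.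
  have := metric_triangle z x y; rewrite (metric_sym z x) -/r.
  by move: yr; rewrite /B/=; lra.
rewrite (reg_op_split M10 gM (mN x) (mA _ _) (disjE x) (splitE x W0)).
rewrite (reg_op_split M10 gM (mN z) (mA _ _) (disjE z) (splitE z Wz0)).
have [ix _] := HCa g M1 x M10 gM; have [iz _] := HCa g M1 z M10 gM.
have iWx := cintegrableS (mA x 0) (mA x _) W0 ix.
have iWz := cintegrableS (mA z 0) (mA x _) Wz0 iz.
have [iF leF] := HCf g M1 x z M10 gM xz.
have [iK _] := @kernel_integrable x (2 * r) W r20 (mA _ _) (fun y => @ltW _ _ _ _).
(* Isolating the increment of g between x and z, which does not depend on y,
   leaves the bare kernel under the integral sign. *)
have farE : cintegral mu W (diff_kernel g x) - cintegral mu W (diff_kernel g z) =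
    cintegral mu W (fun y => (K x y - K z y) * (g y - g z)) +
    (g z - g x) * cintegral mu W (K x).
  rewrite -cintegralB//; last exact: mA.
  rewrite -cintegralZl//; last exact: mA.
  rewrite -cintegralD//; [|exact: mA|].
    by apply: eq_cintegral => y _; rewrite /diff_kernel; ring.
  exact: cintegrableZl (mA _ _) iK.
rewrite opprD addrACA farE.
apply: (@le_trans _ _ (Cn * M1 * (4 * r) `^ beta + Cn * M1 * (4 * r) `^ beta +
  (Cf * M1 * r `^ beta + M1 * r `^ beta * (C3 + 2 * (C1 * m))))); last first.
  rewrite powRM ?(ltW r0)//.
  by rewrite le_eqVlt; apply/orP; left; apply/eqP; ring.
apply: le_trans (le_normcD _ _) _; apply: lerD.
  by apply: le_trans (le_normcB _ _) _; exact: lerD.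
apply: le_trans (le_normcD _ _) _; apply: lerD => //.
rewrite normcM; apply: ler_pM; rewrite ?normc_ge0//.
- by rewrite /r metric_sym; exact: gM.
- exact: away_kernel_le.
Qed.

Lemma truncated_expand f g M1 x e : cmeasurable_fun setT f -> 0 <= M1 ->
  holder beta M1 g -> f = g %[ae mu] -> 0 < e ->
  truncated mu K f x e =
    cintegral mu (away x e) (diff_kernel g x) + g x * truncated mu K (cst 1) x e.
Proof.
move=> mf M10 gM fg e0; have mg := holder_cmeasurable beta0 M10 gM.
have A0 : away x e `<=` away x 0 by apply: away_subset; exact: ltW.
have [_ _ /(_ g M1 x M10 gM)[ig _]] := diff_kernel_all.
have iD := cintegrableS (mA x 0) (mA x e) A0 ig.
have [iK _] := @kernel_integrable x e (away x e) e0 (mA _ _) (fun y => @ltW _ _ _ _).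
have mK := kernel_measurable (mA x e) A0.
rewrite /truncated -/(away x e).
rewrite (@ae_eq_cintegral _ _ _ mu (away x e) _ (fun y => K x y * g y) (mA _ _)).
- rewrite (@eq_cintegral _ _ _ mu _ (fun y => K x y * cst 1 y) (K x)).
    rewrite -(cintegralZl _ (mA x e) iK).
    rewrite -(cintegralD (mA x e) iD (cintegrableZl _ (mA x e) iK)).
    by apply: eq_cintegral => y _; rewrite /diff_kernel; ring.
  by move=> y _; rewrite mulr1.
- by apply: cmeasurableM => //; exact: cmeasurable_funS mf.
- by apply: cmeasurableM => //; exact: cmeasurable_funS mg.
- by apply: filterS fg => y /(_ I) ->.
Qed.

(** Subtracting g(x) from g(y) turns the truncated integral of f into the part of
    [reg_op g x] away from x; what is lost is the integral over
    0 < d(x,y) <= e. *)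
Lemma truncated_error : exists2 C, 0 <= C &
  forall f g M1 x e, cmeasurable_fun setT f -> 0 <= M1 ->
    holder beta M1 g -> f = g %[ae mu] -> 0 < e ->
    normc (truncated mu K f x e -
           (reg_op g x + g x * truncated mu K (cst 1) x e)) <= C * M1 * e `^ beta.
Proof.
have [C C0 HC] := diff_kernel_near.
exists (C * 2 `^ beta); first by rewrite mulr_ge0// powR_ge0.
move=> f g M1 x e mf M10 gM fg e0.
rewrite (truncated_expand x mf M10 gM fg e0).
pose N := away x 0 `&` [set y | mdist x y <= e].
have mN : measurable N by apply: measurableI => //; exact: measurable_mdist_le.
have A0 : away x e `<=` away x 0 by apply: away_subset; exact: ltW.
rewrite (@reg_op_split g M1 x N (away x e) M10 gM mN (mA _ _)); first last.
- apply/seteqP; split => y.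
    by move=> xy; have [?|?] := leP (mdist x y) e; [left; split|right].
  by case=> [[]//|/A0].
- by apply/disj_setPS => y [[_ /= ye] /(le_lt_trans ye)]; rewrite ltxx.
rewrite (_ : _ - _ = - cintegral mu N (diff_kernel g x)); last by ring.
rewrite normcN (_ : C * _ * _ * _ = C * M1 * (2 * e) `^ beta); last first.
  by rewrite powRM// ?(ltW e0)//; ring.
apply: HC => //; first by rewrite mulr_gt0.
by move=> y [xy /= ye]; rewrite xy/=; apply: le_lt_trans ye _; lra.
Qed.

Lemma truncated_one_cvg x :
  cvg ((cintegral mu [set y : X | e < mdist x y < 1] (K x) : R[i]^o)
           @[e --> (0 : R)^'+]) ->
  cvg (truncated mu K (cst 1) x e @[e --> (0 : R)^'+]).
Proof.
move=> /cvg_ex[/= L HL]; apply/cvg_ex.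
exists (L + (cintegral mu [set y | 1 <= mdist x y] (K x)) : R[i]^o).
apply: cvg_trans (cvgD HL (cvg_cst _)).
apply: near_eq_cvg; near=> e.
have e0 : 0 < e by near: e; exact: nbhs_right_gt.
have e1 : e < 1 by near: e; exact: nbhs_right_lt.
transitivity (cintegral mu (away x e) (K x)).
  by rewrite (away_kernel_split x e0 e1).
by apply: eq_cintegral => y _; rewrite mulr1.
Unshelve. all: by end_near. Qed.

Lemma truncated_cvg f g M1 x (L : R[i]^o) : cmeasurable_fun setT f -> 0 <= M1 ->
  holder beta M1 g -> f = g %[ae mu] ->
  truncated mu K (cst 1) x e @[e --> (0 : R)^'+] --> L ->
  truncated mu K f x e @[e --> (0 : R)^'+] --> (reg_op g x + g x * L : R[i]^o).
Proof.
move=> mf M10 gM fg HL; have [C C0 HC] := truncated_error.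
pose main e : R[i]^o := reg_op g x + g x * truncated mu K (cst 1) x e.
have main_cvg : main e @[e --> (0 : R)^'+] --> (reg_op g x + g x * L : R[i]^o).
  by apply: cvgD; [exact: cvg_cst|apply: cvgM HL; exact: cvg_cst].
have err : (truncated mu K f x e - main e) @[e --> (0 : R)^'+] --> (0 : R[i]^o).
  apply: (@cvg_complex0 _ beta (C * M1)) => //; first exact: mulr_ge0.
  by move=> e e0; exact: HC.
rewrite -[_ + g x * L]add0r; apply: cvg_trans (cvgD err main_cvg).
apply: near_eq_cvg; near=> e.
by transitivity (truncated mu K f x e - main e + main e); last rewrite subrK.
Unshelve. all: by end_near. Qed.

(** Compare x and z through a good point y with d(x,y) < d(x,z), so that d(y,z)
    is at most 2 d(x,z). *)
Lemma reg_op_holder C3 : is_support mu [set: X] -> 0 <= C3 ->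
  {ae mu, forall x, forall r1 r2 : R, 0 < r1 -> r1 < r2 ->
    normc (cintegral mu [set y : X | r1 < mdist x y < r2] (K x)) <= C3} ->
  exists2 C, 0 <= C &
    forall g M1, 0 <= M1 -> holder beta M1 g -> holder beta (C * M1) (reg_op g).
Proof.
move=> hsupp C30 good; have [C C0 HC] := reg_op_holder_good C30.
exists (C * (1 + 2 `^ beta)).
  by rewrite mulr_ge0// addr_ge0// powR_ge0.
move=> g M1 M10 gM x z; have [->|xz] := eqVneq x z.
  by rewrite subrr normc0 !mulr_ge0 ?powR_ge0// addr_ge0// powR_ge0.
have xz0 : 0 < mdist x z by rewrite mdist_gt0.
have [y xy goody] := ae_dense hsupp x good xz0.
have [tx tz] := (HC g M1 y x M10 gM goody, HC g M1 y z M10 gM goody).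
rewrite (_ : _ - _ = (reg_op g y - reg_op g z) - (reg_op g y - reg_op g x));
  last by ring.
apply: le_trans (le_normcB _ _) _.
apply: (@le_trans _ _
    (C * M1 * (2 * mdist x z) `^ beta + C * M1 * mdist x z `^ beta)).
  apply: lerD; [apply: le_trans tz _|apply: le_trans tx _];
    rewrite ler_wpM2l ?mulr_ge0// powR_le ?mdist_ge0 ?(ltW beta0)//.
    have := metric_triangle y x z; rewrite (metric_sym y x); lra.
  by rewrite metric_sym ltW.
rewrite powRM ?(ltW xz0)//.
by rewrite le_eqVlt; apply/orP; left; apply/eqP; ring.
Qed.

End Kernel.

(** * The equivalence *)

Theorem theorem3 (R : realType) (d : measure_display) (X : borelMetricType d R)
    (mu : {finite_measure set X -> \bar R}) (n gamma beta : R)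
    (K : X -> X -> R[i])
    (hn : 0 < n) (hgrowth : growth_condition mu n)
    (hsupp : is_support mu [set: X])
    (hgamma : 0 < gamma <= 1)
    (hKmeas : forall x : X, cmeasurable_fun [set y | y != x] (K x))
    (hK : standard_kernel n gamma K)
    (hi : bounded_annular_integrals mu K)
    (hii : convergent_local_integrals mu K)
    (hbeta : 0 < beta) (hbeta_lt : beta < Num.min n gamma) :
  (forall f : X -> R[i], Lip mu beta f ->
     {ae mu, forall x, cvg (truncated mu K f x e @[e --> (0 : R)^'+])}) /\
  (in_Lip mu beta (pv mu K (cst 1)) <-> Lip_bounded mu beta (pv mu K)).
Proof.
have /andP[beta_n beta_gamma] : (beta < n) && (beta < gamma) by rewrite -lt_min.
have [[C1' hK1'] [C2' hK2']] := hK; have [C3' hi'] := hi.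
have hK1 x y : x != y -> normc (K x y) <= `|C1'| / mdist x y `^ n.
  move=> xy; apply: le_trans (hK1' x y xy) _.
  by rewrite ler_wpM2r ?ler_norm// invr_ge0 powR_ge0.
have hK2 (x1 x2 y : X) : x1 != y -> 2 * mdist x1 x2 <= mdist x1 y ->
    normc (K x1 y - K x2 y) <=
      `|C2'| * (mdist x1 x2 `^ gamma / mdist x1 y `^ (n + gamma)).
  move=> xy xyz; apply: le_trans (hK2' x1 x2 y xy xyz) _.
  by rewrite ler_wpM2r ?ler_norm// divr_ge0 ?powR_ge0.
have [C10 C20] := (normr_ge0 C1', normr_ge0 C2').
have one_cvg : {ae mu, forall x,
    cvg (truncated mu K (cst 1) x e @[e --> (0 : R)^'+])}.
  apply: filterS hii => x; exact: (truncated_one_cvg hn hKmeas C10 hK1).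
have lim_repr f g M1 x : Lip mu beta f -> 0 <= M1 -> holder beta M1 g ->
    f = g %[ae mu] ->
    cvg (truncated mu K (cst 1) x e @[e --> (0 : R)^'+]) ->
    truncated mu K f x e @[e --> (0 : R)^'+] -->
      (reg_op mu K g x + g x * pv mu K (cst 1) x : R[i]^o).
  move=> [mf _] M10 gM fg cvg1.
  exact: (truncated_cvg hn hgrowth hKmeas C10 hK1 hbeta beta_n mf M10 gM fg cvg1).
have decomp f := @Lip_rep_bounds _ _ _ mu beta hbeta hsupp n f hn hgrowth.
split.
  move=> f Lf; have [g [M0 [M1 [fg [_ M10] _ gM _]]]] := decomp f Lf.
  apply: filterS one_cvg => x cvg1.
  exact: cvgP (lim_repr f g M1 x Lf M10 gM fg cvg1).
split=> [[k Lk K1k]|[C bd]]; last first.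
  have [||L1 _] := @holder_Lip _ _ _ mu beta hbeta hsupp 1 0 (cst 1) ler01 (lexx 0).
  - by move=> x; rewrite normc1.
  - by move=> x y; rewrite subrr normc0 mul0r.
  by have [h [Lh Kh _]] := bd _ L1; exists h.
have [h [N0 [N1 [kh [N00 N10] hN0 hN1 _]]]] := decomp k Lk.
have [Cs Cs0 HCs] := diff_kernel_all hgrowth hKmeas C10 hK1 hbeta beta_n.
have good : {ae mu, forall x, forall r1 r2 : R, 0 < r1 -> r1 < r2 ->
    normc (cintegral mu [set y : X | r1 < mdist x y < r2] (K x)) <= `|C3'|}.
  apply: filterS hi' => x hx r1 r2 r10 r12.
  exact: le_trans (hx r1 r2 r10 r12) (ler_norm _).
have [Ch Ch0 HCh] := reg_op_holder hn hgrowth hKmeas C10 C20 hK1 hK2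
  hbeta beta_n beta_gamma hsupp (normr_ge0 C3') good.
(* Cs and Ch bound the supremum and the Hoelder constant of the regularized part;
   N0 and N1 are those of the representative of K1. *)
exists (Cs + Ch + N0 + N1) => f Lf.
have [g [M0 [M1 [fg [M00 M10] gM0 gM1 normE]]]] := decomp f Lf.
pose H x := reg_op mu K g x + g x * h x.
have H0 x : normc (H x) <= Cs * M1 + M0 * N0.
  apply: le_trans (le_normcD _ _) _; apply: lerD.
    by have [_] := HCs g M1 x M10 gM1.
  by rewrite normcM; apply: ler_pM; rewrite ?normc_ge0.
have H1 : holder beta (Ch * M1 + (M0 * N1 + M1 * N0)) H.
  exact: holderM_add (HCh g M1 M10 gM1) gM1 hN1 gM0 hN0.
have [||LH normH] := holder_Lip hbeta hsupp _ _ H0 H1.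
- by rewrite addr_ge0// mulr_ge0.
- by rewrite !addr_ge0// mulr_ge0.
exists H; split => //.
  apply: filterS3 one_cvg K1k kh => x cvg1 /(_ I) K1x /(_ I) khx _.
  rewrite /H -khx -K1x.
  exact: cvg_lim (lim_repr f g M1 x Lf M10 gM1 fg cvg1).
apply: le_trans normH _; rewrite normE -EFinM lee_fin.
have : 0 <= Cs * M0 by exact: mulr_ge0.
have : 0 <= Ch * M0 by exact: mulr_ge0.
have : 0 <= N1 * M1 by exact: mulr_ge0.
lra.
Qed.
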